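(* There is a universal constant $c>0$ such that for all integers $n\ge 1$, $m$ and $\ell$ with $1\le \ell<m/4-2$ the following holds. Let $\mathcal{A}$ be a deterministic clock synchronization algorithm that is correct on every $\ell$-connected graph with $m$ vertices with uncertainty parameter $n$. Then there exist an $\ell$-connected $m$-vertex graph (with processors assigned to its vertices) and wake-up times in $\{0,1,\dots,n\}$ such that, in the resulting execution of $\mathcal{A}$, the sum over all processors of their radio use is at least $c\, m\sqrt{n/\ell}$. Consequently the energy efficiency of $\mathcal{A}$ on $\ell$-connected graphs is $\Omega(\sqrt{n/\ell})$ both when it is defined as the worst-case maximum radio use of a processor and when it is defined as the worst-case average radio use over the processors.
   Context: A graph is called $\ell$-connected here if any pair of distinct vertices is connected by at least $\ell$ pairwise edge-disjoint paths. Model. A network is an undirected graph $G=(V,E)$ with $m$ vertices, the processors, which carry distinct identities $1,\dots,m$. Global time is divided into discrete time units $0,1,2,\dots$ and is not available to the processors. Processor $i$ wakes up at the beginning of global time unit $t_i\in\{0,1,\dots,n\}$. The $t_i$ are chosen arbitrarily and are unknown to the processors; the uncertainty parameter $n$ (and $m$) are known to all processors, but the graph $G$ is not. In each time unit after wake-up a processor's radio is either on or off (before wake-up it is off). If in a global time unit the radios of two adjacent processors are both on, each receives the message sent by the other in that time unit; a processor receives the messages of all its neighbours whose radios are on (there is no interference). Processors that are not adjacent cannot communicate directly. If its radio is off, a processor neither sends nor receives. A deterministic algorithm decides for each processor, as a deterministic function of $n$, $m$, the identity of the processor, the number of time units since its own wake-up, and all messages received in earlier time units, whether the radio is on in the current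 time unit; the content of messages is likewise determined by the information available to the processor. A clock synchronization algorithm is correct on $G$ if for all wake-up times $t_1,\dots,t_m\in\{0,1,\dots,n\}$ its execution contains a global time unit in which the radios of all $m$ processors are simultaneously on (and the processors synchronize their clocks in it). The radio use of a processor in an execution is the number of time units during which its radio is on. The energy efficiency of an algorithm is considered in two scenarios: (first) the maximum radio use of a processor, in the worst case; (second) the average over the processors of their radio use, in the worst case. *)

(* Defs.v *)
From HB Require Import structures.
From mathcomp Require Import all_boot all_order all_algebra.
From mathcomp Require Import all_classical all_reals all_analysis.

Set Implicit Arguments.
Unset Strict Implicit.
Unset Printing Implicit Defensive.

Import Order.TTheory GRing.Theory Num.Theory.

Local Open Scope classical_set_scope.
Local Open Scope ring_scope.

(* The processors are the vertices: the identity k in 1, ..., m is the ordinal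
   of value k - 1, so ranging over all graphs on 'I_m includes ranging over all
   assignments of the m identities to the vertices. *)
Record network (m : nat) := Network {
  adj :> rel 'I_m;
  adj_sym : symmetric adj;
  adj_irr : irreflexive adj
}.

(* The undirected edges traversed by the walk x :: p. *)
Definition path_edges (V : finType) (x : V) (p : seq V) : seq {set V} :=
  pairmap (fun u v => [set u; v]%SET) x p.

Definition edge_connected (l m : nat) (G : network m) : Prop :=
  forall x y : 'I_m, x != y ->
  exists P : 'I_l -> seq 'I_m,
    (forall k, [/\ path G x (P k), uniq (x :: P k) & last x (P k) = y]) /\
    (forall k1 k2, k1 != k2 ->
       {in path_edges x (P k1), forall e, e \notin path_edges x (P k2)}).

(* What a processor receives in one time unit: for each j, the message from j,
   if there is one. *)
Definition reception (m : nat) (M : Type) := {ffun 'I_m -> option M}.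

(* The arguments are n, m, the identity, the number of time units since the
   processor's own wake-up, and the receptions in all the earlier time units
   since then, oldest first. *)
Record algorithm := Algorithm {
  message : Type;
  radio : forall n m : nat, 'I_m -> nat -> seq (reception m message) -> bool;
  content : forall n m : nat, 'I_m -> nat -> seq (reception m message) -> message
}.
Arguments radio _ _ [_] _ _ _.
Arguments content _ _ [_] _ _ _.

Section Execution.
Variables (A : algorithm) (n m : nat) (G : network m) (t : 'I_m -> 'I_n.+1).

Let histories := 'I_m -> seq (reception m (message A)).

Definition radio_at (h : histories) (T : nat) (i : 'I_m) : bool :=
  (t i <= T)%N && radio A n i (T - t i)%N (h i).

Definition receives_at (h : histories) (T : nat) (i : 'I_m) :
    reception m (message A) :=
  [ffun j => if [&& G i j, radio_at h T i & radio_at h T j]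
             then Some (content A n j (T - t j)%N (h j)) else None].

(* The histories at the beginning of the global time unit T. *)
Fixpoint history (T : nat) : histories :=
  if T is T'.+1 then
    let h := history T' in
    fun i => if (t i <= T')%N then rcons (h i) (receives_at h T' i) else [::]
  else fun=> [::].

Definition radio_on (T : nat) (i : 'I_m) : bool := radio_at (history T) T i.

(* An extended real, because a radio may be on in infinitely many time units. *)
Definition radio_use (R : realType) (i : 'I_m) : \bar R :=
  (\sum_(0 <= T <oo) ((radio_on T i)%:R%:E : \bar R))%E.

Definition total_radio_use (R : realType) : \bar R :=
  (\sum_(i < m) radio_use R i)%E.

Definition max_radio_use (R : realType) : \bar R :=
  \big[maxe/0%E]_(i < m) radio_use R i.

Definition average_radio_use (R : realType) : \bar R :=
  (total_radio_use R * (m%:R^-1)%:E)%E.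

End Execution.

(* Clocks are not part of the state: setting them once all the radios are on
   at the same time puts no further constraint on the radios. *)
Definition correct_on (A : algorithm) (n m : nat) (G : network m) : Prop :=
  forall t : 'I_m -> 'I_n.+1, exists T : nat, forall i, radio_on A G t T i.

Definition worst_case (R : realType) (n l m : nat)
    (cost : network m -> ('I_m -> 'I_n.+1) -> \bar R) : \bar R :=
  ereal_sup [set u | exists (G : network m) (t : 'I_m -> 'I_n.+1),
                       edge_connected l G /\ u = cost G t].

Definition max_energy (R : realType) (A : algorithm) (n l m : nat) : \bar R :=
  worst_case l (fun (G : network m) (t : 'I_m -> 'I_n.+1) =>
                  max_radio_use A G t R).

Definition average_energy (R : realType) (A : algorithm) (n l m : nat) : \bar R :=
  worst_case l (fun (G : network m) (t : 'I_m -> 'I_n.+1) =>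
                  average_radio_use A G t R).

(* Main.v *)
Require Import Defs.
From HB Require Import structures.
From mathcomp Require Import all_boot all_order all_algebra.
From mathcomp Require Import all_classical all_reals all_analysis.
From mathcomp Require Import zify ring lra.

Set Implicit Arguments.
Unset Strict Implicit.
Unset Printing Implicit Defensive.

Import Order.TTheory GRing.Theory Num.Theory.

Local Open Scope ring_scope.

(* Take two cliques of about m/2 processors joined by a matching of l edges, which
   is an l-connected graph, and let the right clique wake up s time units after
   the left one. Until both ends of a matching edge are on simultaneously, each
   clique behaves as if it were alone, in a way that depends neither on the
   matching nor on s. As all radios are on together at some time, such a first
   meeting exists. If no execution uses more than K time units of radio in total,
   each clique has at most K possible pairs (processor, local time) for its end of
   the first meeting. Letting the matching range over the h^2 pairs of cyclic
   shifts (p, q) in a_(p+k) -- b_(q+k), k < l, and s over 0, ..., n, the triple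
   (p, q, s) is determined by k and these two pairs, so h^2 (n+1) <= l K^2. *)

(** * Connectivity of two cliques joined by a matching *)

Section TwoCliques.
Variables (m l : nat) (side : 'I_m -> bool) (a : 'I_l -> bool -> 'I_m).

Definition two_cliques_rel : rel 'I_m := fun u v =>
  (u != v) && ((side u == side v) ||
               [exists k, (u == a k (side u)) && (v == a k (side v))]).

Lemma two_cliques_sym : symmetric two_cliques_rel.
Proof.
move=> u v; rewrite /two_cliques_rel eq_sym [side u == _]eq_sym.
by congr (_ && (_ || _)); apply: eq_existsb => k; rewrite andbC.
Qed.

Lemma two_cliques_irr : irreflexive two_cliques_rel.
Proof. by move=> u; rewrite /two_cliques_rel eqxx. Qed.

Definition two_cliques : network m :=
  Network two_cliques_sym two_cliques_irr.

Hypothesis side_a : forall k b, side (a k b) = b.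
Hypothesis a_inj : forall b, injective (a^~ b).
Hypothesis side_card : forall b, (l + 2 <= #|[set i | side i == b]|)%N.

(** A clique of at least [l + 2] vertices has [l] vertices besides [x] and [y]; each is the midpoint
    of a path of length two. *)
Lemma two_cliques_same_side (x y : 'I_m) : x != y -> side x = side y ->
  exists P : 'I_l -> seq 'I_m,
    (forall k, [/\ path two_cliques x (P k), uniq (x :: P k)
                 & last x (P k) = y]) /\
    (forall k1 k2, k1 != k2 ->
       {in path_edges x (P k1), forall e, e \notin path_edges x (P k2)}).
Proof.
move=> xy sxy.
pose Z := [set i | side i == side x]%SET :\: [set x; y]%SET.
have cZ : (l <= #|Z|)%N.
  have := side_card (side x); have := cardsID [set x; y]%SET [set i | side i == side x]%SET.
  have : (#|([set i | side i == side x] :&: [set x; y])%SET| <= 2)%N.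
    by rewrite (leq_trans (subset_leq_card (subsetIr _ _))) // cards2 xy.
  by rewrite -/Z; lia.
pose z (k : 'I_l) := enum_val (widen_ord cZ k).
have zP k : [/\ side (z k) = side x, z k != x & z k != y].
  have := enum_valP (widen_ord cZ k); rewrite -/(z k) !inE negb_or.
  by case/andP => /andP [] ? ? /eqP.
have z_inj : injective z.
  by move=> k1 k2 /enum_val_inj /(congr1 val) /= /val_inj.
exists (fun k => [:: z k; y]); split=> [k|k1 k2 k12 e].
  have [s1 zx zy] := zP k; split=> //=.
    by rewrite /two_cliques_rel eq_sym zx s1 eqxx zy sxy eqxx.
  by rewrite !inE eq_sym negb_or zx xy zy.
have zk : z k1 != z k2 by apply: contra_neq k12 => /z_inj.
have [_ z1x z1y] := zP k1.
have z1 : z k1 \in e -> e \notin path_edges x [:: z k2; y].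
  apply: contraL; rewrite /path_edges /= !inE.
  by case/orP => /eqP ->; rewrite !inE (negbTE zk) ?(negbTE z1x) ?(negbTE z1y).
by move=> ee; apply: z1; move: ee; rewrite !inE => /orP [] /eqP ->; rewrite !inE eqxx ?orbT.
Qed.

(** The [k]-th path crosses by the [k]-th matching edge, dropping its first or last step when [x] or
    [y] is itself an end of that edge. *)
Lemma two_cliques_across (x y : 'I_m) : side x != side y ->
  exists P : 'I_l -> seq 'I_m,
    (forall k, [/\ path two_cliques x (P k), uniq (x :: P k)
                 & last x (P k) = y]) /\
    (forall k1 k2, k1 != k2 ->
       {in path_edges x (P k1), forall e, e \notin path_edges x (P k2)}).
Proof.
move=> sxy.
have xy : x != y by apply: contra_neq sxy => ->.
pose P k := (if a k (side x) == x then [::] else [:: a k (side x)]) ++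
  a k (side y) :: (if a k (side y) == y then [::] else [:: y]).
have diff k u v : side u != side v -> a k (side u) != v.
  by move=> uv; apply: contraNneq uv => <-; rewrite side_a.
(* Each edge of the [k]-th path identifies [k]: it contains a matched vertex of index [k] other than
   [x] and [y], or it is the matching edge joining [x] to [y]. *)
have PE k e : e \in path_edges x (P k) ->
    (forall v, v \in e -> [|| v == x, v == y | v == a k (side v)]) /\
    ((exists2 v, v \in e & (v == a k (side v)) && (v \notin [:: x; y])) \/
     (e = [set x; y]%SET /\ x = a k (side x))).
  have axy : a k (side x) != y by apply: diff.
  have ayx : a k (side y) != x by apply: diff; rewrite eq_sym.
  rewrite /path_edges /P; case: eqP => [ax|/eqP ax]; case: eqP => [ay|/eqP ay] /=;
    rewrite !inE => E;
    repeat (case/orP: E => [E|E]); move/eqP: E => ->; split;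
    try (by move=> v; rewrite !inE => /orP [] /eqP ->; rewrite ?side_a ?eqxx ?orbT //
              1?eq_sym ?ax ?ay ?eqxx ?orbT);
    try (by right; rewrite ?ay ?ax);
    left;
    try (by exists (a k (side x)); rewrite !inE ?side_a ?eqxx ?orbT //= negb_or ax axy);
    by exists (a k (side y)); rewrite !inE ?side_a ?eqxx ?orbT //= negb_or ay ayx.
exists P; split=> [k|k1 k2 k12 e e1].
  have axy : a k (side x) != y by apply: diff.
  have ayx : a k (side y) != x by apply: diff; rewrite eq_sym.
  have aa : a k (side x) != a k (side y) by apply: diff; rewrite side_a.
  have near v : a k (side v) != v ->
      two_cliques_rel v (a k (side v)) /\ two_cliques_rel (a k (side v)) v.
    by move=> av; rewrite ![two_cliques_rel _ v]two_cliques_sym /two_cliques_rel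
      eq_sym av side_a eqxx.
  have mid : two_cliques_rel (a k (side x)) (a k (side y)).
    rewrite /two_cliques_rel aa !side_a; apply/orP; right.
    by apply/existsP; exists k; rewrite !eqxx.
  rewrite /P; case: eqP => [ax|/eqP ax]; case: eqP => [ay|/eqP ay];
    rewrite ?ax ?ay in mid aa axy ayx; split=> //=;
    rewrite ?mid ?(near _ ax).1 ?(near _ ay).2 // ?inE ?negb_or ?(eq_sym x) ?ax ?ay
      ?ayx ?aa ?axy ?(eq_sym y) ?xy //= ?mid //.
apply/negP => e2.
have [all1 w1] := PE _ _ e1; have [all2 w2] := PE _ _ e2.
have common k k' v : v = a k (side v) -> v = a k' (side v) -> k = k'.
  by move=> vk vk'; apply: (a_inj (b := side v)); rewrite -vk -vk'.
case: w1 => [[v ve /andP [/eqP va]]|[ee xa]].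
  rewrite !inE negb_or => /andP [/negbTE vx /negbTE vy].
  have := all2 _ ve; rewrite vx vy /= => /eqP va2.
  by rewrite (common _ _ _ va va2) eqxx in k12.
case: w2 => [[v ve /andP [_ vxy]]|[_ xa2]].
  by rewrite ee !inE in ve; rewrite !inE ve in vxy.
by rewrite (common _ _ _ xa xa2) eqxx in k12.
Qed.

Lemma two_cliques_connected : edge_connected l two_cliques.
Proof.
move=> x y xy; case: (eqVneq (side x) (side y)) => sxy.
  exact: two_cliques_same_side.
exact: two_cliques_across.
Qed.

End TwoCliques.

(** * Executions up to the first meeting *)

Section Executions.
Variables (A : algorithm) (n m l : nat) (side : 'I_m -> bool).

(* No edge crosses, the matching being indexed by 'I_0. *)
Definition isolated_sides : network m :=
  two_cliques side (fun k _ => widen_ord (leq0n m) k).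

Definition at_zero (i : 'I_m) : 'I_n.+1 := ord0.

(** All processors wake at time 0 here, so [T] is the local time of [i]. *)
Definition on_alone (T : nat) (i : 'I_m) : bool :=
  radio_on A isolated_sides at_zero T i.

Variables (a : 'I_l -> bool -> 'I_m) (s : 'I_n.+1).
Hypothesis side_a : forall k b, side (a k b) = b.

Definition wake_up (i : 'I_m) : 'I_n.+1 := if side i then ord0 else s.

Let G := two_cliques side a.

(** Meetings are read off the isolated execution; [s <= T] keeps [T - s] from being truncated. *)
Definition meet (T : nat) (k : 'I_l) : bool :=
  [&& (s <= T)%N, on_alone T (a k true) & on_alone (T - s) (a k false)].

(** By induction: a message over a matching edge would need both its ends on, hence a meeting, and
    wake-up times agree within a side, so each side is only shifted in time. *)
Lemma history_before_meet (T : nat) :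
  (forall T' k, (T' < T)%N -> ~~ meet T' k) ->
  forall i, history A G wake_up T i =
    history A isolated_sides at_zero (T - wake_up i) i.
Proof.
elim: T => [|T IH] nomeet i //=.
have {}IH := IH (fun T' k lt => nomeet T' k (ltnW lt)).
(* A processor still asleep has an empty history, as at local time 0. *)
case: leqP => [le|lt]; last first.
  by have -> : (T.+1 - wake_up i = 0)%N by lia.
rewrite subSn //= IH; congr rcons.
have rad j : radio_at wake_up (history A G wake_up T) T j =
    (wake_up j <= T)%N && on_alone (T - wake_up j) j.
  by rewrite /radio_at IH /on_alone /radio_on /radio_at /= subn0.
apply/ffunP => j; rewrite !ffunE !rad le /= subn0.
have radi j' : radio_at at_zero
    (history A isolated_sides at_zero (T - wake_up i)) (T - wake_up i) j' = on_alone (T - wake_up i) j' by [].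
rewrite !radi /two_cliques_rel.
have -> : [exists k : 'I_0, (i == widen_ord (leq0n m) k) && (j == widen_ord (leq0n m) k)]
    = false by apply/existsP => -[[]].
case: (eqVneq (side i) (side j)) => [sij|sij] /=.
  have wij : wake_up j = wake_up i by rewrite /wake_up sij.
  by rewrite IH wij le.
rewrite andbF /=.
case: ifP => // /and4P [/andP [_ /existsP [k /andP [/eqP ia /eqP ja]]] oni lej onj].
case/negP: (nomeet T k (leqnn _)).
move: oni onj le lej sij; rewrite /meet /wake_up {}ia {}ja !side_a.
by case: (side i); case: (side j) => //=; rewrite ?subn0 => -> -> le1 le2; rewrite ?le1 ?le2.
Qed.

Lemma radio_on_before_meet (T : nat) (i : 'I_m) :
  (forall T' k, (T' < T)%N -> ~~ meet T' k) ->
  radio_on A G wake_up T i =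
    (wake_up i <= T)%N && on_alone (T - wake_up i) i.
Proof.
move=> nomeet; rewrite /radio_on /radio_at history_before_meet //.
by rewrite /on_alone /radio_on /radio_at /= subn0.
Qed.

(** Without any meeting the sides would behave as if isolated forever, yet the time unit in which
    all radios are on makes the ends of edge [k0] meet. *)
Lemma first_meet (k0 : 'I_l) : correct_on A n G ->
  exists T k, meet T k /\ forall T' k', (T' < T)%N -> ~~ meet T' k'.
Proof.
move=> /(_ wake_up) [T0 allon].
have [|none] := pselect (exists T, [exists k, meet T k]).
  move=> ex; case: (ex_minnP ex) => T /existsP [k meetk] minT.
  exists T, k; split=> // T' k' lt; apply/negP => m'.
  by have := minT T' (introT existsP (ex_intro _ k' m')); rewrite leqNgt lt.
have nomeet T k : ~~ meet T k.
  by apply/negP => mk; apply: none; exists T; apply/existsP; exists k.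
case/negP: (nomeet T0 k0); rewrite /meet.
have := allon (a k0 true); have := allon (a k0 false).
rewrite !radio_on_before_meet; try by move=> *; apply: nomeet.
by rewrite /wake_up !side_a /= subn0 => /andP [-> ->] ->.
Qed.

(** This carries a radio budget over to the isolated execution. The unit [T] itself is included, as
    radios in it depend only on earlier receptions. *)
Lemma radio_alone_le (T : nat) (i : 'I_m) :
  (forall T' k, (T' < T)%N -> ~~ meet T' k) -> (wake_up i <= T)%N ->
  (\sum_(u < (T - wake_up i).+1) on_alone u i <=
   \sum_(0 <= T' < T.+1) radio_on A G wake_up T' i)%N.
Proof.
move=> nomeet le; rewrite -subSn //.
rewrite -(big_mkord xpredT (fun u => nat_of_bool (on_alone u i))).
rewrite (big_cat_nat (leq0n _) (leqW le)) /= (leq_trans _ (leq_addl _ _)) //.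
rewrite -[X in (_ <= \sum_(X <= _ < _) _)%N]add0n big_addn.
rewrite leq_eqVlt; apply/orP; left; apply/eqP; apply: eq_big_nat => u /andP [_ ult].
rewrite radio_on_before_meet ?leq_addl ?addnK //.
by move=> T' k lt; apply: nomeet; lia.
Qed.

End Executions.

(** Prefix sums are monotone, so the selected indices form an initial segment, whose total is a
    prefix sum bounded by [K]. *)
Lemma truncated_sum_le (d : nat -> nat) (K Z : nat) :
  (\sum_(u < Z | \sum_(v < u.+1) d v <= K) d u <= K)%N.
Proof.
(* The bound by the full sum lets the induction add the last term. *)
suff : (\sum_(u < Z | \sum_(v < u.+1) d v <= K) d u <= minn K (\sum_(v < Z) d v))%N.
  by rewrite leq_min => /andP [].
elim: Z => [|Z IH]; first by rewrite !big_ord0.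
rewrite big_mkcond big_ord_recr -big_mkcond /= [in leqRHS]big_ord_recr /=.
move: IH; rewrite !leq_min => /andP [IHK IHZ].
case: ifP => [le|_]; last by rewrite addn0 IHK (leq_trans IHZ) ?leq_addr.
rewrite leq_add2r IHZ andbT (leq_trans _ le) //.
by rewrite [leqRHS]big_ord_recr leq_add2r.
Qed.

(** * Counting shifted matchings and delays *)

Section Matching.
Variables (A : algorithm) (n m l h K : nat).
Hypotheses (two_h : (h.+1.*2 <= m)%N) (l_lt_h : (l + 2 <= h.+1)%N).

Fact vertex_subproof (b : bool) (i : 'I_h.+1) : (~~ b * h.+1 + i < m)%N.
Proof. by have := ltn_ord i; move: two_h; case: b => /=; lia. Qed.

(** Addition in ['I_h.+1] is modulo [h.+1], which provides the cyclic shifts. Vertices from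
    [h.+1.*2] on are unmatched members of the right clique. *)
Definition vertex (b : bool) (i : 'I_h.+1) : 'I_m := Ordinal (vertex_subproof b i).

Definition left_side (i : 'I_m) : bool := (i < h.+1)%N.

Definition matching (p q : 'I_h.+1) (k : 'I_l) (b : bool) : 'I_m :=
  vertex b ((if b then p else q) + inZp k).

Lemma vertex_inj b : injective (vertex b).
Proof. by move=> i j /(congr1 val) /= /addnI /val_inj. Qed.

Lemma left_side_vertex b i : left_side (vertex b i) = b.
Proof. by have := ltn_ord i; rewrite /left_side /=; case: b => /=; lia. Qed.

Lemma matching_connected p q :
  edge_connected l (two_cliques left_side (matching p q)).
Proof.
apply: two_cliques_connected => [k b|b k1 k2 /vertex_inj /addrI /(congr1 val) /=|b].
- exact: left_side_vertex.
- have lt (k : 'I_l) : (k < h.+1)%N by have := ltn_ord k; move: l_lt_h; lia.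
  by rewrite !modn_small // => /val_inj.
- rewrite (leq_trans l_lt_h) //.
  rewrite -[X in (X <= _)%N]card_ord -(card_imset _ (@vertex_inj b)).
  apply: subset_leq_card; apply/fintype.subsetP => i /imsetP [j _ ->].
  by rewrite inE left_side_vertex.
Qed.

Hypothesis correct :
  forall G : network m, edge_connected l G -> correct_on A n G.
Hypothesis radio_le :
  forall (G : network m) (t : 'I_m -> 'I_n.+1), edge_connected l G ->
  forall T, (\sum_(i < m) \sum_(0 <= T' < T) radio_on A G t T' i <= K)%N.

Let on (b : bool) (T : nat) (i : 'I_h.+1) := on_alone A n left_side T (vertex b i).
Let use (b : bool) (T : nat) := (\sum_(u < T) \sum_(i < h.+1) on b u i)%N.

Lemma sum_vertex_le b (F : 'I_m -> nat) :
  (\sum_(i < h.+1) F (vertex b i) <= \sum_(i < m) F i)%N.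
Proof.
rewrite -(big_imset (h := vertex b) F (A := 'I_h.+1)) /=; last first.
  by move=> i j _ _ /vertex_inj.
rewrite [leqRHS](bigID (mem (vertex b @: 'I_h.+1))) /= (leq_trans _ (leq_addr _ _)) //.
Qed.

(** Each of the last two clauses constrains one end by the isolated execution of its own clique, so
    the admissible ends form sets independent of [p], [q] and [s]; the budget [K] keeps these sets
    small. *)
Lemma matched_meet (p q : 'I_h.+1) (s : 'I_n.+1) (k0 : 'I_l) :
  exists x : nat * 'I_l,
    [/\ (s <= x.1)%N,
        on true x.1 (p + inZp x.2) && (use true x.1.+1 <= K)%N
      & on false (x.1 - s) (q + inZp x.2) && (use false (x.1 - s).+1 <= K)%N].
Proof.
pose a := matching p q.
have side_a k b : left_side (a k b) = b by apply: left_side_vertex.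
have conn : edge_connected l (two_cliques left_side a) by apply: matching_connected.
have [T [k [/and3P [sT onT onF] nomeet]]] :=
  first_meet s side_a k0 (correct conn).
(* Wake-up times are constant on a side, so [vertex b ord0] stands for all its vertices. *)
have useK b : (wake_up left_side s (vertex b ord0) <= T)%N ->
    (use b (T - wake_up left_side s (vertex b ord0)).+1 <= K)%N.
  move=> le.
  rewrite (leq_trans _ (radio_le (wake_up left_side s) conn T.+1)) //.
  rewrite (leq_trans _ (sum_vertex_le b _)) // /use exchange_big /=.
  apply: leq_sum => i _.
  have wi : wake_up left_side s (vertex b ord0) = wake_up left_side s (vertex b i).
    by rewrite /wake_up !left_side_vertex.
  by rewrite wi radio_alone_le // -wi.
exists (T, k); split=> //=.
  rewrite /on onT /=; have := useK true.
  by rewrite /wake_up left_side_vertex /= subn0; apply.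
rewrite /on onF /=; have := useK false.
by rewrite /wake_up left_side_vertex /=; apply.
Qed.

(* A matching (p, q) and a delay s are recovered from the first edge on which
   the two sides meet and the local times of its two ends at that moment. *)
Lemma matching_count : (0 < l)%N -> (h.+1 ^ 2 * n.+1 <= l * K ^ 2)%N.
Proof.
move=> l_gt0; pose k0 := Ordinal l_gt0.
pose X : finType := ('I_h.+1 * 'I_h.+1 * 'I_n.+1)%type.
have [W WP] := choice (fun x : X => matched_meet x.1.1 x.1.2 x.2 k0).
(* A common horizon for the finitely many meeting times makes the sets of ends finite. *)
pose Z := (\max_x (W x).1)%N.
have WZ x : ((W x).1 < Z.+1)%N by rewrite ltnS; apply: leq_bigmax.
have WZ' x : ((W x).1 - x.2 < Z.+1)%N by apply: leq_ltn_trans (leq_subr _ _) (WZ x).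
pose S b := [set iu : 'I_h.+1 * 'I_Z.+1 | on b iu.2 iu.1 && (use b iu.2.+1 <= K)%N]%SET.
have cardS b : (#|S b| <= K)%N.
  rewrite -sum1dep_card.
  rewrite (eq_bigl (fun iu : 'I_h.+1 * 'I_Z.+1 =>
    xpredT iu.1 && (on b iu.2 iu.1 && (use b iu.2.+1 <= K)%N))) //.
  rewrite -(pair_big_dep xpredT (fun i (u : 'I_Z.+1) => on b u i && (use b u.+1 <= K)%N)
    (fun _ _ => 1%N)) /=.
  rewrite (exchange_big_dep (fun u : 'I_Z.+1 => (use b u.+1 <= K)%N)) /=; last first.
    by move=> i u _ /andP [].
  rewrite (leq_trans _ (truncated_sum_le (fun u => \sum_(i < h.+1) on b u i)%N K Z.+1)) //.
  apply: leq_sum => u uK; rewrite big_mkcond /=; apply: leq_sum => i _.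
  by rewrite uK andbT; case: (on b u i).
pose f (x : X) : 'I_l * ('I_h.+1 * 'I_Z.+1) * ('I_h.+1 * 'I_Z.+1) :=
  ((W x).2, (x.1.1 + inZp (W x).2, Ordinal (WZ x)),
   (x.1.2 + inZp (W x).2, Ordinal (WZ' x))).
have f_inj : injective f.
  move=> [[p q] s] [[p' q'] s'] e.
  have ek : (W (p, q, s)).2 = (W (p', q', s')).2 := congr1 (fun y => y.1.1) e.
  have := congr1 (fun y => y.1.2.1) e; rewrite /= ek => /addIr ep.
  have := congr1 (fun y => y.2.1) e; rewrite /= ek => /addIr eq.
  have eqT : (W (p, q, s)).1 = (W (p', q', s')).1 := congr1 (fun y => val y.1.2.2) e.
  have eqT' : ((W (p, q, s)).1 - s = (W (p', q', s')).1 - s')%N :=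
    congr1 (fun y => val y.2.2) e.
  (* As [s] is at most the meeting time, it is the difference of the two local times. *)
  have [/= le _ _] := WP (p, q, s); have [/= le' _ _] := WP (p', q', s').
  rewrite ep eq; congr (_, _); apply: val_inj => /=.
  by rewrite -(subKn le) -(subKn le') eqT' eqT.
have : (#|f @: [set: X]%SET| <= #|finset.setX (finset.setX [set: 'I_l]%SET (S true)) (S false)|)%N.
  apply: subset_leq_card; apply/fintype.subsetP => y /imsetP [x _ ->].
  by have [_ onT onF] := WP x; rewrite !inE /= onT onF.
rewrite card_imset // !cardsX !cardsT !card_prod !card_ord => le.
rewrite -!mulnn (leq_trans le) // -mulnA leq_mul // leq_mul //.
Qed.

End Matching.

(** * Comparison of the extended-real costs *)

Section RadioUse.
Variables (R : realType) (A : algorithm) (n m : nat) (G : network m).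
Variable t : 'I_m -> 'I_n.+1.

Lemma partial_le_total_radio_use (T : nat) :
  (((\sum_(i < m) \sum_(0 <= T' < T) radio_on A G t T' i)%N%:R : R)%:E
     <= total_radio_use A G t R)%E.
Proof.
rewrite natr_sum -sumEFin; apply: lee_sum => i _.
rewrite natr_sum -sumEFin; apply: nneseries_lim_ge => u _ _.
by rewrite lee_fin.
Qed.

Lemma max_radio_use_ge0 : (0 <= max_radio_use A G t R)%E.
Proof.
rewrite /max_radio_use; elim/big_ind: _ => // [x y x0 y0|i _].
  by rewrite le_max x0.
by apply: nneseries_ge0 => T _ _; rewrite lee_fin.
Qed.

Lemma average_le_max_radio_use : (0 < m)%N ->
  (average_radio_use A G t R <= max_radio_use A G t R)%E.
Proof.
move=> m_gt0; rewrite /average_radio_use lee_pdivrMr ?ltr0n //.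
have le : (total_radio_use A G t R <= \sum_(i < m) max_radio_use A G t R)%E.
  by apply: lee_sum => i _; apply: le_bigmax.
apply: (le_trans le); move: max_radio_use_ge0.
case: (max_radio_use A G t R) => [r| |] // _.
  by rewrite sumEFin sumr_const card_ord -EFinM mulr_natr.
by rewrite gt0_mulye ?leey // lte_fin ltr0n.
Qed.

End RadioUse.

Theorem theorem4p5 (R : realType) :
  exists c : R, 0 < c /\
  forall n m l : nat,
    (1 <= n)%N -> (1 <= l)%N -> (l%:R < m%:R / 4%:R - 2%:R :> R) ->
  forall A : algorithm,
    (forall G : network m, edge_connected l G -> correct_on A n G) ->
  [/\ exists (G : network m) (t : 'I_m -> 'I_n.+1),
        edge_connected l G /\
        ((c * m%:R * Num.sqrt (n%:R / l%:R))%:E <= total_radio_use A G t R)%E,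
      ((c * Num.sqrt (n%:R / l%:R))%:E <= max_energy R A n l m)%E
    & ((c * Num.sqrt (n%:R / l%:R))%:E <= average_energy R A n l m)%E].
Proof.
(* With [m <= 3 * h.+1], this constant gives [l * B ^ 2 <= 9/16 * h.+1 ^ 2 * n], which is less than
   [h.+1 ^ 2 * n.+1]. *)
exists (4%:R^-1); split; first by rewrite invr_gt0 ltr0n.
move=> n m l n1 l1 lm A correct.
have lm' : (4 * l + 8 < m)%N.
  by rewrite -(ltr_nat R) natrD natrM; move: lm; lra.
have m_gt0 : (0 < m)%N by apply: leq_ltn_trans lm'.
set B : R := 4%:R^-1 * m%:R * Num.sqrt (n%:R / l%:R).
have [G [t [conn use]]] : exists (G : network m) (t : 'I_m -> 'I_n.+1),
    edge_connected l G /\ (B%:E <= total_radio_use A G t R)%E.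
  apply: contrapT => none.
  have B0 : 0 <= B by rewrite !mulr_ge0 ?sqrtr_ge0 ?invr_ge0.
  (* The matched part of each clique, of size [h.+1], is half of [m] rounded down. *)
  pose h := (m./2).-1.
  have two_h : (h.+1.*2 <= m)%N by rewrite /h; lia.
  have l_lt_h : (l + 2 <= h.+1)%N by rewrite /h; lia.
  have three_h : (m <= 3 * h.+1)%N by rewrite /h; lia.
  (* If the bound fails, every total is below [B], so the floor of [B] serves as the integer
     budget. *)
  have radio_le (G : network m) (t : 'I_m -> 'I_n.+1) : edge_connected l G ->
      forall T, (\sum_(i < m) \sum_(0 <= T' < T) radio_on A G t T' i <= Num.truncn B)%N.
    move=> conn T; rewrite truncn_ge_nat // -lee_fin.
    apply: (le_trans (partial_le_total_radio_use R A G t T)).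
    rewrite leNgt; apply/negP => lt; apply: none.
    by exists G, t; split=> //; apply: ltW.
  have := matching_count two_h l_lt_h correct radio_le l1.
  rewrite -(ler_nat R) !natrM -!expr2 => count.
  have KB : (Num.truncn B)%:R ^+ 2 <= B ^+ 2 by rewrite lerXn2r ?nnegrE ?truncn_le.
  have lB : l%:R * B ^+ 2 = m%:R ^+ 2 * n%:R / 16%:R :> R.
    rewrite /B !exprMn sqr_sqrtr ?divr_ge0 //.
    have : (l%:R : R) != 0 by rewrite pnatr_eq0 -lt0n.
    by move=> l0; field.
  have hm : (m%:R : R) <= 3%:R * h.+1%:R by rewrite -natrM ler_nat.
  have hm2 : (m%:R : R) ^+ 2 <= 9%:R * h.+1%:R ^+ 2.
    rewrite (_ : 9%:R * _ = (3%:R * h.+1%:R) ^+ 2); last by ring.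
    by rewrite lerXn2r ?nnegrE // mulr_ge0.
  have hn : (h.+1%:R : R) ^+ 2 * n.+1%:R <= 9%:R * h.+1%:R ^+ 2 * n%:R / 16%:R.
    apply: (le_trans count); apply: (@le_trans _ _ (l%:R * B ^+ 2)).
      by rewrite ler_wpM2l.
    by rewrite lB ler_wpM2r // ler_wpM2r.
  have h2 : 0 < (h.+1%:R : R) ^+ 2 by rewrite exprn_gt0.
  have : (0 : R) <= n%:R by [].
  by move: hn; rewrite -natr1; nra.
have average : ((4%:R^-1 * Num.sqrt (n%:R / l%:R))%:E <=
    average_radio_use A G t R)%E.
  rewrite /average_radio_use lee_pdivlMr ?ltr0n // -EFinM.
  by rewrite mulrAC.
split; first by exists G, t.
  apply: (le_trans average); apply: (le_trans (average_le_max_radio_use R A G t m_gt0)).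
  by apply: ereal_sup_ubound; exists G, t.
by apply: (le_trans average); apply: ereal_sup_ubound; exists G, t.
Qed.
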